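(* Let $M$ be an $L$-structure and $\phi(x,y)$ an $L$-formula. Let $\epsilon>0$ and suppose $\phi(x,y)$ is $\epsilon$-stable in $M$. Fix $\gamma>\delta>0$ and let $p\in S_{\phi(x)}(M)$. Then there are finitely many $a_0,\ldots,a_{n-1}\in M^x$ such that, for all $b,c\in M^y$, if $\mathfrak d(\phi^M(a_i,b),\phi^M(a_i,c))<\delta$ for all $i<n$, then $\mathfrak d(\phi(p,b),\phi(p,c))<2\epsilon+\gamma$.
   Context: Logic: We work in continuous (metric) first-order logic with values in $\mathfrak V=\ell^\infty(\omega)$ (real Banach space), with metric $\mathfrak d(\mathfrak r,\mathfrak s)=\|\mathfrak r-\mathfrak s\|_\infty$; an isometric copy $\mathbb R\hookrightarrow\mathfrak V$ is fixed. It is set up as standard $[0,1]$-valued continuous logic (complete metric structures, possibly many-sorted, symbols with prescribed moduli of uniform continuity), except that each predicate symbol $P$ of the language $L$ comes with a compact set $K_P\subseteq\mathfrak V$ in which it takes values; connectives are all continuous functions $u:\mathfrak V^n\to\mathfrak V$; and $\sup_x\psi$, $\inf_x\psi$ are formed only for formulas $\psi$ with value set $K_\psi\subseteq\mathbb R^{\geq0}$. Inductively each formula $\phi$ has a compact value set $K_\phi\subseteq\mathfrak V$ ($K_{u(\phi_0,\ldots,\phi_{n-1})}=u(\prod_i K_{\phi_i})$, and $K_{\sup_x\psi}=K_{\inf_x\psi}=K_\psi$), and $\phi^M$ takes values in $K_\phi$ in every $L$-structure $M$. Here $x,y$ are tuples of variables and $M^x$ is the product of sorts of $M$ corresponding to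 $x$. $N\succeq M$ means $N$ is an elementary extension of $M$. Types: $S_{\phi(x)}(M)$ is the set of complete $\phi(x)$-types over $M$. A type $p\in S_{\phi(x)}(M)$ is determined by the function $b\mapsto\phi(p,b)$ from $M^y$ to $K_\phi$, where $\phi(p,b)=\phi^N(a,b)$ for any realization $a\in N^x$ of $p$ in some $N\succeq M$. Stability: $\phi(x,y)$ is $\epsilon$-stable in $M$ if there are no sequences $\langle a_i\rangle_{i<\omega}$ in $M^x$ and $\langle b_i\rangle_{i<\omega}$ in $M^y$ such that $\mathfrak d(\phi^M(a_i,b_j),\phi^M(a_j,b_i))\geq\epsilon$ for all $i<j<\omega$. *)

(* Defs.v *)
From HB Require Import structures.
From mathcomp Require Import all_boot all_order all_algebra.
From mathcomp Require Import all_classical all_reals all_analysis.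

Set Implicit Arguments.
Unset Strict Implicit.
Unset Printing Implicit Defensive.

Import Order.TTheory GRing.Theory Num.Theory.
Import numFieldNormedType.Exports.
Local Open Scope classical_set_scope.
Local Open Scope ring_scope.

Section EllInf.
Variable R : realType.

Definition bounded_seq : {pred (nat -> R^o)} :=
  [pred x : nat -> R^o | `[< has_ubound (range (fun n => `|x n|)) >]].

Record ellinf : Type := EllInf {
  ellinf_val :> nat -> R^o ; ellinf_valP : ellinf_val \in bounded_seq }.

HB.instance Definition _ := [isSub for ellinf_val].
HB.instance Definition _ := [Choice of ellinf by <:].

Lemma bounded_seqP (x : nat -> R^o) :
  reflect (exists C : R, forall n, `|x n| <= C) (x \in bounded_seq).
Proof.
apply: (iffP idP) => [/asboolP[C ub]|[C ub]].
  by exists C => n; apply: ub; exists n.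
by apply/asboolP; exists C => _ [n _ <-].
Qed.

Lemma bounded_seq_submod_closed : submod_closed bounded_seq.
Proof.
split.
  by apply/bounded_seqP; exists 0 => n; rewrite normr0.
move=> k x y /bounded_seqP[C xC] /bounded_seqP[D yD].
apply/bounded_seqP; exists (`|k| * C + D) => n.
rewrite (le_trans (ler_normD _ _))// lerD//.
by rewrite normrM ler_wpM2l.
Qed.

HB.instance Definition _ := GRing.isSubmodClosed.Build R (nat -> R^o)
  bounded_seq bounded_seq_submod_closed.
HB.instance Definition _ := [SubChoice_isSubLmodule of ellinf by <:].

Definition ellinf_norm (x : ellinf) : R := sup (range (fun n => `|x n|)).

Lemma ellinf_norm_ub (x : ellinf) n : `|x n| <= ellinf_norm x.
Proof.
by apply: ub_le_sup; [exact/asboolP/(ellinf_valP x) | exists n].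
Qed.

Lemma ellinf_norm_le (x : ellinf) (C : R) :
  (forall n, `|x n| <= C) -> ellinf_norm x <= C.
Proof.
by move=> xC; apply: ge_sup; [exists `|x 0%N|, 0%N | move=> _ [n _ <-]].
Qed.

Lemma ellinf_normD x y :
  ellinf_norm (x + y) <= ellinf_norm x + ellinf_norm y.
Proof.
apply: ellinf_norm_le => n.
by rewrite (le_trans (ler_normD _ _))// lerD// ellinf_norm_ub.
Qed.

Lemma ellinf_norm_ge0 x : 0 <= ellinf_norm x.
Proof. exact: le_trans (normr_ge0 (x 0%N)) (ellinf_norm_ub _ _). Qed.

Lemma ellinf_normZ (l : R) x : ellinf_norm (l *: x) = `|l| * ellinf_norm x.
Proof.
have leZ (k : R) y : ellinf_norm (k *: y) <= `|k| * ellinf_norm y.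
  apply: ellinf_norm_le => n.
  by rewrite normrM ler_wpM2l// ellinf_norm_ub.
apply/eqP; rewrite eq_le leZ/=.
have [->|l0] := eqVneq l 0.
  by rewrite normr0 mul0r ellinf_norm_ge0.
have := leZ l^-1 (l *: x).
by rewrite scalerA mulVf// scale1r normfV ler_pdivlMl ?normr_gt0.
Qed.

Lemma ellinf_norm0_eq0 x : ellinf_norm x = 0 -> x = 0.
Proof.
move=> x0; apply/val_inj/funext => n; apply/eqP.
by rewrite -normr_le0 -x0 ellinf_norm_ub.
Qed.

HB.instance Definition _ := Lmodule_isNormed.Build R ellinf
  ellinf_normD ellinf_normZ ellinf_norm0_eq0.

Lemma ellinf_complete (F : set_system ellinf) :
  ProperFilter F -> cauchy F -> cvg F.
Proof.
move=> FF Fc; have {}Fc (e : R) : 0 < e -> exists x : ellinf, F (ball x e).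
  by move/cauchyP: Fc; apply.
have co (x y : ellinf) n (e : R) : ball x e y -> `|x n - y n| < e.
  rewrite -ball_normE /= => xy; apply: le_lt_trans xy.
  exact: (ellinf_norm_ub (x - y) n).
have cn n : cvg ((fun x : ellinf => x n) @ F).
  apply: cauchy_cvg; apply/cauchy_exP => e e0.
  have [x Fx] := Fc _ e0; exists (x n).
  by apply: (@filterS _ F _ (ball x e)) Fx => y /(co _ _ n); rewrite -ball_normE.
pose l n : R^o := lim ((fun x : ellinf => x n) @ F).
have lx (x : ellinf) (e : R) : F (ball x e) -> forall n, `|x n - l n| <= e.
  move=> Fx n; rewrite leNgt; apply/negP => ltx.
  have /cvgrPdist_lt/(_ (`|x n - l n| - e)) := cn n.
  rewrite subr_gt0 => /(_ ltx) Fl.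
  have [y [/(co _ _ n) xy ly]] := filter_ex (filterI Fx Fl).
  have := ler_distD (y n) (x n) (l n).
  rewrite leNgt => /negP; apply.
  rewrite -[ltRHS](subrKC e) ltrD// distrC.
  exact: ly.
have [x0 Fx0] := Fc 1 ltr01.
have lb : l \in bounded_seq.
  apply/bounded_seqP; exists (ellinf_norm x0 + 1) => n.
  rewrite -[l n](subrKC (x0 n)) (le_trans (ler_normD _ _))// lerD//.
    exact: ellinf_norm_ub.
  by rewrite distrC lx.
apply/cvg_ex; exists (EllInf lb); apply/cvgrPdist_le => /= e e0.
have e20 : 0 < e / 2 by rewrite divr_gt0.
have [x Fx] := Fc _ e20.
near=> y; apply: ellinf_norm_le => n.
rewrite [leRHS]splitr (le_trans (ler_distD (x n) _ _))// lerD//.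
  by rewrite distrC; exact: lx.
by apply/ltW/co; near: y.
Unshelve. all: by end_near. Qed.

HB.instance Definition _ := Uniform_isComplete.Build ellinf ellinf_complete.

End EllInf.

#[short(type="completeMetricType")]
HB.structure Definition CompleteMetric (R : numDomainType) :=
  {M of Metric R M & Complete M}.

Section Syntax.
Variable R : realType.

(* The fixed isometric copy of the reals is a parameter; linearity is not
   required. *)
Record real_copy := RealCopy {
  emb :> R -> ellinf R ;
  emb_isometry : forall r s, `|emb r - emb s| = `|r - s| }.

(* A finite tuple of sorted variables: an index type with a sort for each
   index. *)
Record vartuple (S : Type) := VarTuple { tvar :> finType ; tsort : tvar -> S }.

Definition vcat (S : Type) (x y : vartuple S) : vartuple S :=
  VarTuple (fun v : (x + y)%type =>
    match v with inl i => tsort i | inr j => tsort j end).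

(* The moduli follow the usual convention for continuous logic: a symbol with
   modulus [Delta] satisfies
   [d(a, a') < Delta e -> d(f a, f a') <= e] for all [e > 0],
   products of sorts being given the maximum metric. *)
Record language := Language {
  lsort : Type ;
  fsym : Type ;
  fdom : fsym -> vartuple lsort ;
  fcod : fsym -> lsort ;
  fmod : fsym -> R -> R ;
  fmod_gt0 : forall f e, 0 < e -> 0 < fmod f e ;
  psym : Type ;
  pdom : psym -> vartuple lsort ;
  pval : psym -> set (ellinf R) ;
  pval_compact : forall P, compact (pval P) ;
  pmod : psym -> R -> R ;
  pmod_gt0 : forall P e, 0 < e -> 0 < pmod P e }.

Variables (iota : real_copy) (L : language).

Inductive term (x : vartuple (lsort L)) : lsort L -> Type :=
| TVar (v : x) : term x (tsort v)
| TApp (f : fsym L) (ts : forall i : fdom f, term x (tsort i)) : term x (fcod f).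

(* [formula x K] is the type of formulas with variables among [x] whose
   inductively computed value set is [K].  Quantifiers bind a tuple [y]; the
   formula under the quantifier has variables [vcat x y]. *)
Inductive formula (x : vartuple (lsort L)) : set (ellinf R) -> Type :=
| FRel (P : psym L) (ts : forall i : pdom P, term x (tsort i)) :
    formula x (pval P)
| FDist (s : lsort L) (t1 t2 : term x s) :
    formula x (iota @` [set r | 0 <= r <= 1])
| FConn (n : nat) (u : {ptws 'I_n -> ellinf R} -> ellinf R)
    (K : 'I_n -> set (ellinf R)) :
    continuous u -> (forall i, formula x (K i)) ->
    formula x (u @` [set v | forall i, K i (v i)])
| FSup (y : vartuple (lsort L)) (K : set (ellinf R)) :
    K `<=` iota @` [set r | 0 <= r] -> formula (vcat x y) K -> formula x K
| FInf (y : vartuple (lsort L)) (K : set (ellinf R)) :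
    K `<=` iota @` [set r | 0 <= r] -> formula (vcat x y) K -> formula x K.

End Syntax.

Definition points (S : Type) (C : S -> Type) (x : vartuple S) : Type :=
  forall v : x, C (tsort v).

Definition pcat (S : Type) (C : S -> Type) (x y : vartuple S)
    (a : points C x) (b : points C y) : points C (vcat x y) :=
  fun v => match v with inl i => a i | inr j => b j end.

(* Sorts are nonempty ([completeMetricType] is pointed) and have diameter at
   most 1. *)
Record structure (R : realType) (L : language R) := Structure {
  carrier :> lsort L -> completeMetricType R ;
  mdist_le1 : forall s (a b : carrier s), mdist a b <= 1 ;
  finterp : forall f : fsym L, points carrier (fdom f) -> carrier (fcod f) ;
  finterp_uc : forall f (a b : points carrier (fdom f)) e, 0 < e ->
    (forall i, mdist (a i) (b i) < fmod f e) ->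
    mdist (finterp a) (finterp b) <= e ;
  pinterp : forall P : psym L, points carrier (pdom P) -> ellinf R ;
  pinterp_val : forall P (a : points carrier (pdom P)), pval P (pinterp a) ;
  pinterp_uc : forall P (a b : points carrier (pdom P)) e, 0 < e ->
    (forall i, mdist (a i) (b i) < pmod P e) ->
    `|pinterp a - pinterp b| <= e }.

Notation "M ^^ x" := (points (carrier M) x)
  (at level 30, right associativity) : type_scope.

Section Semantics.
Variables (R : realType) (iota : real_copy R) (L : language R).

Fixpoint teval (M : structure L) (x : vartuple (lsort L)) (s : lsort L)
    (t : term x s) (a : M ^^ x) {struct t} : M s :=
  match t in term _ s return M s with
  | TVar v => a v
  | TApp f ts => finterp (fun i => teval (ts i) a)
  end.

Fixpoint feval (M : structure L) (x : vartuple (lsort L)) (K : set (ellinf R))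
    (phi : formula iota x K) {struct phi} : M ^^ x -> ellinf R :=
  match phi with
  | FRel P ts => fun a => pinterp (fun i => teval (ts i) a)
  | FDist _ t1 t2 => fun a => iota (mdist (teval t1 a) (teval t2 a))
  | FConn _ u _ _ psi => fun a => u (fun i => feval (psi i) a)
  | FSup y _ _ psi => fun a =>
      iota (sup [set r | exists c : M ^^ y, iota r = feval psi (pcat a c)])
  | FInf y _ _ psi => fun a =>
      iota (inf [set r | exists c : M ^^ y, iota r = feval psi (pcat a c)])
  end.

(* [N >= M], with the inclusion of [M] in [N] replaced by an elementary map
   [incl].  Preserving all formulas, in particular the metric and the formulas
   [d(f(x), y)], makes [incl] an isometric embedding of structures. *)
Record elem_ext (M : structure L) := ElemExt {
  ext :> structure L ;
  incl : forall s, M s -> ext s ;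
  incl_elem : forall x K (phi : formula iota x K) (a : M ^^ x),
    feval phi (fun v => incl (a v)) = feval phi a }.

Variables (x y : vartuple (lsort L)) (K : set (ellinf R)).
Variables (phi : formula iota (vcat x y) K) (M : structure L).

(* A complete phi-type over [M] is the phi-type over [M] of some tuple in some
   elementary extension; it is represented by the function [b |-> phi(p, b)]
   that determines it. *)
Record phi_type := PhiType {
  type_val :> M ^^ y -> ellinf R ;
  type_realized : exists (N : elem_ext M) (a : N ^^ x), forall b : M ^^ y,
    type_val b = feval phi (pcat a (fun v => incl N (b v))) }.

Definition eps_stable (eps : R) : Prop :=
  ~ exists (a : nat -> M ^^ x) (b : nat -> M ^^ y), forall i j, (i < j)%N ->
      eps <= `|feval phi (pcat (a i) (b j)) - feval phi (pcat (a j) (b i))|.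

End Semantics.

(* Main.v *)
(** Suppose there is no such finite family. Then one chooses inductively
    [a_n], [b_n], [c_n] such that [phi(p, b_n)] and [phi(p, c_n)] are at
    distance at least [2 eps + gamma], while [phi(a_i, b_n)] and [phi(a_i,
    c_n)] are at distance less than [delta] for [i < n], and [a_n]
    approximates [p] at [b_i] and [c_i] for [i < n]. By Ramsey's theorem and
    stability some pair [i < j] has both [phi(a_i, b_j)] close to [phi(a_j,
    b_i)] and [phi(a_i, c_j)] close to [phi(a_j, c_i)], up to [eps]. Passing
    from [phi(p, b_i)] to [phi(p, c_i)] through [phi(a_j, b_i)], [phi(a_i,
    b_j)], [phi(a_i, c_j)], [phi(a_j, c_i)] then gives a distance less than [2
    eps + gamma].

    The approximation of [p] by elements of [M] is elementarity applied to the
    formula [inf_x sum_i |phi(x, y_i) - r_i|] with [r_i = phi(p, b_i)]. *)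
Require Import Defs.
From mathcomp Require Import all_boot all_order all_algebra.
From mathcomp Require Import all_classical all_reals all_analysis.
From mathcomp Require Import lra.

Set Implicit Arguments.
Unset Strict Implicit.
Unset Printing Implicit Defensive.

Import Order.TTheory GRing.Theory Num.Theory.
Import numFieldNormedType.Exports.
Local Open Scope classical_set_scope.
Local Open Scope ring_scope.

(** * Sequences chosen along their history, and Ramsey's theorem for pairs *)

Lemma history_choice (T : Type) (x0 : T) (D : T -> Prop) (R : T -> T -> Prop) :
  (forall s : seq T, (forall i, (i < size s)%N -> D (nth x0 s i)) ->
    exists t, D t /\ forall i, (i < size s)%N -> R (nth x0 s i) t) ->
  exists g : nat -> T, (forall n, D (g n)) /\
    forall i j, (i < j)%N -> R (g i) (g j).
Proof.
move=> H.
(* On lists violating [D] the function [F] may take the junk value [x0]; [DF] below shows that the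
   lists [S n] of earlier terms never violate [D]. *)
have /choice[F FP] (s : seq T) : exists t,
    (forall i, (i < size s)%N -> D (nth x0 s i)) ->
    D t /\ forall i, (i < size s)%N -> R (nth x0 s i) t.
  have [/H[t tP]|ns] := pselect (forall i, (i < size s)%N -> D (nth x0 s i)).
    by exists t.
  by exists x0.
pose S n := iter n (fun s => rcons s (F s)) [::].
have sizeS n : size (S n) = n by elim: n => //= n IH; rewrite size_rcons IH.
have nthS n i : (i < n)%N -> nth x0 (S n) i = F (S i).
  elim: n => // n IH; rewrite ltnS leq_eqVlt /= nth_rcons sizeS.
  by case/orP => [/eqP ->|lt_in]; rewrite ?ltnn ?eqxx // lt_in IH.
have DF n : D (F (S n)).
  elim/ltn_ind: n => n IH; apply: (FP _ _).1 => i.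
  by rewrite sizeS => lt_in; rewrite nthS //; exact: IH.
exists (fun n => F (S n)); split=> // i j lt_ij.
rewrite -(nthS j) //; apply: (FP _ _).2; last by rewrite sizeS.
by move=> k; rewrite sizeS => lt_kj; rewrite nthS.
Qed.

(** An ultrafilter [U] containing all tails decides whether [P i j] holds for [U]-most [j], and then
    which answer occurs for [U]-most [i]. A homogeneous sequence is built greedily from that
    answer. *)
Lemma ramsey_pairs (P : nat -> nat -> Prop) :
  exists g : nat -> nat, (forall i j, (i < j)%N -> (g i < g j)%N) /\
    ((forall i j, (i < j)%N -> P (g i) (g j)) \/
     (forall i j, (i < j)%N -> ~ P (g i) (g j))).
Proof.
have [U [UU subU]] := ultraFilterLemma eventually_filter.
have homogeneous (Q : nat -> nat -> Prop) :
    U [set i | U [set j | Q i j]] ->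
    exists g : nat -> nat, forall i j, (i < j)%N ->
      (g i < g j)%N /\ Q (g i) (g j).
  move=> UQ.
  have [|g [_ gP]] := @history_choice nat 0%N (fun i => U [set j | Q i j])
      (fun i j => (i < j)%N /\ Q i j); last by exists g.
  move=> s Ds.
  (* A finite intersection of members of [U]: tails and, by the invariant, the sets of good
     successors of the earlier terms. *)
  have Us : U [set t | forall i : 'I_(size s), (nth 0%N s i < t)%N /\
      Q (nth 0%N s i) t].
    apply: (@filter_forall _ _ (fun (i : 'I_(size s)) t =>
      (nth 0%N s i < t)%N /\ Q (nth 0%N s i) t)) => i.
    apply: filterI; last exact: Ds.
    by apply: subU; exact: nbhs_infty_gt.
  have [t [Dt tP]] := filter_ex (filterI UQ Us).
  by exists t; split=> // i lt_is; exact: (tP (Ordinal lt_is)).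
have [UP|UnP] := in_ultra_setVsetC [set i | U [set j | P i j]] UU.
  have [g gP] := homogeneous P UP.
  by exists g; split=> [i j /gP[]//|]; left=> i j /gP[].
have [|g gP] := homogeneous (fun i j => ~ P i j).
  apply: filterS UnP => i /= nUP.
  by have [] := in_ultra_setVsetC [set j | P i j] UU.
by exists g; split=> [i j /gP[]//|]; right=> i j /gP[].
Qed.

(** * Substitution of terms into formulas *)

Section Substitution.
Variables (R : realType) (iota : real_copy R) (L : language R).

Definition subst (x z : vartuple (lsort L)) := forall v : x, term z (tsort v).

Fixpoint tsubst (x z : vartuple (lsort L)) (sg : subst x z) (s : lsort L)
    (t : term x s) : term z s :=
  match t in term _ s return term z s with
  | TVar v => sg v
  | TApp f ts => TApp (fun i => tsubst sg (ts i))
  end.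

(** Bound variables form a separate summand, so capture cannot occur: the terms [sg i] only have to
    be weakened. *)
Definition lift_subst (x z w : vartuple (lsort L)) (sg : subst x z) :
    subst (vcat x w) (vcat z w) :=
  fun v => match v return term (vcat z w) (@tsort _ (vcat x w) v) with
  | inl i => tsubst (fun k : z => TVar (inl k : vcat z w)) (sg i)
  | inr j => TVar (inr j : vcat z w)
  end.

Fixpoint fsubst (x z : vartuple (lsort L)) (K : set (ellinf R))
    (phi : formula iota x K) : subst x z -> formula iota z K :=
  match phi in formula _ _ K return subst x z -> formula iota z K with
  | FRel P ts => fun sg => FRel iota (fun i => tsubst sg (ts i))
  | FDist _ t1 t2 => fun sg => FDist iota (tsubst sg t1) (tsubst sg t2)
  | FConn _ _ _ uc psi => fun sg => FConn uc (fun i => fsubst (psi i) sg)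
  | FSup w _ Kpos psi => fun sg => FSup Kpos (fsubst psi (@lift_subst _ _ w sg))
  | FInf w _ Kpos psi => fun sg => FInf Kpos (fsubst psi (@lift_subst _ _ w sg))
  end.

Variable M : structure L.

Lemma teval_tsubst (x z : vartuple (lsort L)) (sg : subst x z) (s : lsort L)
    (t : term x s) (a : M ^^ z) :
  teval (tsubst sg t) a = teval t (fun v => teval (sg v) a).
Proof.
by elim: t => //= f ts IH; congr finterp; apply: functional_extensionality_dep.
Qed.

Lemma eval_lift_subst (x z w : vartuple (lsort L)) (sg : subst x z)
    (a : M ^^ z) (c : M ^^ w) :
  (fun v => teval (@lift_subst _ _ w sg v) (pcat a c)) =
  pcat (fun v => teval (sg v) a) c.
Proof.
apply: functional_extensionality_dep => -[i|j] //=.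
by rewrite teval_tsubst.
Qed.

(** Lets several instances of [phi], in different variables, be combined under one quantifier. The
    substitution stays general in the induction because quantifiers lift it. *)
Lemma feval_fsubst (x z : vartuple (lsort L)) (K : set (ellinf R))
    (phi : formula iota x K) (sg : subst x z) (a : M ^^ z) :
  feval (fsubst phi sg) a = feval phi (fun v => teval (sg v) a).
Proof.
elim: phi z sg a => {x K} /=.
- move=> x P ts z sg a; congr pinterp.
  apply: functional_extensionality_dep => i.
  exact: teval_tsubst.
- by move=> x s t1 t2 z sg a; rewrite !teval_tsubst.
- by move=> x n u K uc psi IH z sg a; congr u; apply/funext => i; exact: IH.
- move=> x w K Kpos psi IH z sg a.
  by under eq_set do under eq_exists do rewrite IH eval_lift_subst.
- move=> x w K Kpos psi IH z sg a.
  by under eq_set do under eq_exists do rewrite IH eval_lift_subst.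
Qed.

End Substitution.

Lemma emb_inj (R : realType) (iota : real_copy R) : injective iota.
Proof.
move=> r s eq_rs; apply/eqP; rewrite -subr_eq0 -normr_eq0.
by rewrite -(emb_isometry iota) eq_rs subrr normr0.
Qed.

Lemma emb_continuous (R : realType) (iota : real_copy R) : continuous iota.
Proof.
move=> r; apply/cvgrPdist_lt => e e0.
near=> s; rewrite emb_isometry.
by near: s; apply: (@cvgr_dist_lt _ R^o).
Unshelve. all: by end_near. Qed.

(** The target values [r] are constants of the connective; [iota] puts the real sum back into the
    value space, in the range that [FInf] accepts. *)
Definition sum_dist (R : realType) (iota : real_copy R) n (r : 'I_n -> ellinf R)
  (v : {ptws 'I_n -> ellinf R}) : ellinf R := iota (\sum_i `|v i - r i|).

Lemma sum_dist_continuous (R : realType) (iota : real_copy R) n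
    (r : 'I_n -> ellinf R) : continuous (sum_dist iota r).
Proof.
move=> v.
have cv i : `|w i - r i| @[w --> v] --> (`|v i - r i| : R^o).
  apply: (@cvg_norm R (ellinf R) _ (nbhs v) _ (fun w => w i - r i)).
  apply: (@cvgB R (ellinf R) _ (nbhs v) _ (fun w => w i)); last exact: cvg_cst.
  exact: (@proj_continuous 'I_n (fun=> ellinf R) i v).
have cv_sum := @cvg_big R^o 'I_n _ 0 predT (@add_continuous R^o) _ (nbhs v)
  (index_enum 'I_n) (fun i w => `|w i - r i|) _ _ (fun i _ => cv i).
exact: (cvg_comp _ _ (cv_sum _) (@emb_continuous R iota _)).
Qed.

(** * Approximating a type by tuples of the model *)

Section FiniteSatisfiability.
Variables (R : realType) (iota : real_copy R) (L : language R).
Variables (x y : vartuple (lsort L)) (K : set (ellinf R)).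
Variable phi : formula iota (vcat x y) K.

Definition copies n := VarTuple (fun v : 'I_n * y => tsort v.2).

Definition pcopies (M : structure L) n (b : 'I_n -> M ^^ y) : M ^^ copies n :=
  fun v => b v.1 v.2.

(** The summands are exchanged: [x] must be on the right, where [FInf] binds it, while [y] becomes
    the [i]-th block of free variables. *)
Definition pick_copy n (i : 'I_n) : subst (vcat x y) (vcat (copies n) x) :=
  fun v => match v return term (vcat (copies n) x) (@tsort _ (vcat x y) v) with
  | inl k => TVar (inr k : vcat (copies n) x)
  | inr k => TVar (inl (i, k) : vcat (copies n) x)
  end.

Lemma feval_pick_copy (M : structure L) n (i : 'I_n) (b : 'I_n -> M ^^ y)
    (a : M ^^ x) :
  feval (fsubst phi (pick_copy i)) (pcat (pcopies b) a) =
  feval phi (pcat a (b i)).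
Proof.
rewrite feval_fsubst; congr feval.
by apply: functional_extensionality_dep => -[].
Qed.

Lemma sum_dist_ge0 n (r : 'I_n -> ellinf R) :
  sum_dist iota r @` [set v | forall i, K (v i)] `<=` iota @` [set t | 0 <= t].
Proof.
move=> _ [v _ <-]; exists (\sum_i `|v i - r i|) => //=.
by apply: sumr_ge0 => i _.
Qed.

Definition realizer_inf n (r : 'I_n -> ellinf R) : formula iota (copies n) _ :=
  FInf (@sum_dist_ge0 n r)
    (FConn (@sum_dist_continuous R iota n r)
      (fun i => fsubst phi (pick_copy i))).

Lemma feval_realizer_inf (M : structure L) n (r : 'I_n -> ellinf R)
    (b : 'I_n -> M ^^ y) :
  feval (realizer_inf r) (pcopies b) =
  iota (inf (range (fun a : M ^^ x =>
    \sum_i `|feval phi (pcat a (b i)) - r i|))).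
Proof.
pose psi := FConn (@sum_dist_continuous R iota n r)
  (fun i => fsubst phi (pick_copy i)).
have psiE (a : M ^^ x) : feval psi (pcat (pcopies b) a) =
    iota (\sum_i `|feval phi (pcat a (b i)) - r i|).
  transitivity (sum_dist iota r
    (fun i => feval (fsubst phi (pick_copy i)) (pcat (pcopies b) a))).
    reflexivity.
  apply: (congr1 (emb iota)).
  by apply: eq_bigr => i _; rewrite feval_pick_copy.
transitivity (iota (inf [set t |
    exists a : M ^^ x, iota t = feval psi (pcat (pcopies b) a)])).
  reflexivity.
congr (emb iota (inf _)).
apply/seteqP; split=> t; case=> a.
  by rewrite psiE => /emb_inj ->; exists a.
by move=> _ <-; exists a; rewrite psiE.
Qed.

(** In [N] a realization of [p] makes the infimum vanish. By elementarity the infimum in [M] is the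
    same, so some tuple of [M] brings the sum, and hence each summand, below [eta]. *)
Lemma phi_type_approx (M : structure L) (p : phi_type phi M) n
    (b : 'I_n -> M ^^ y) (eta : R) : 0 < eta ->
  exists a : M ^^ x, forall i, `|feval phi (pcat a (b i)) - p (b i)| < eta.
Proof.
move=> eta0; have [N [a0 a0P]] := type_realized p.
pose D (M' : structure L) (b' : 'I_n -> M' ^^ y) (a : M' ^^ x) : R :=
  \sum_i `|feval phi (pcat a (b' i)) - p (b i)|.
have D_ge0 M' b' a : 0 <= D M' b' a by apply: sumr_ge0.
pose bN i : N ^^ y := fun v => Defs.incl N (b i v).
have infN : inf (range (D N bN)) <= 0.
  apply: ge_inf; first by exists 0 => _ [a _ <-].
  exists a0 => //; rewrite /D big1 // => i _.
  by rewrite a0P subrr normr0.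
have := incl_elem N (realizer_inf (p \o b)) (pcopies b).
rewrite (_ : (fun v => _) = pcopies bN) //.
rewrite !feval_realizer_inf => /emb_inj eq_inf.
have [||_ [a _ <-] Da] := @inf_lt R (range (D M b)) eta.
- by exists (D M b (fun=> point)), (fun=> point).
- by apply: le_lt_trans eta0; move: infN; rewrite eq_inf.
exists a => i; apply: le_lt_trans Da.
by rewrite /D (bigD1 i) //= lerDl sumr_ge0.
Qed.

End FiniteSatisfiability.

(** * Combining stability with the approximation *)

(** Stability directly gives a good pair only for [b] or [c] separately. Along a homogeneous [g] the
    [b]-pairs cannot all be bad, so all are good, and stability for [c] along [g] gives the common
    pair. *)
Lemma eps_stable_common_pair (R : realType) (iota : real_copy R)
    (L : language R) (x y : vartuple (lsort L)) (K : set (ellinf R))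
    (phi : formula iota (vcat x y) K) (M : structure L) (eps : R)
    (a : nat -> M ^^ x) (b c : nat -> M ^^ y) : eps_stable phi M eps ->
  exists i j, [/\ (i < j)%N,
    `|feval phi (pcat (a i) (b j)) - feval phi (pcat (a j) (b i))| < eps &
    `|feval phi (pcat (a i) (c j)) - feval phi (pcat (a j) (c i))| < eps].
Proof.
move=> stable; apply: contrapT => no_pair.
pose unstable d i j :=
  eps <= `|feval phi (pcat (a i) (d j)) - feval phi (pcat (a j) (d i))|.
have [g [g_incr [gb|gb]]] := ramsey_pairs (unstable b).
  by apply: stable; exists (a \o g), (b \o g).
apply: stable; exists (a \o g), (c \o g) => i j lt_ij /=.
rewrite leNgt; apply/negP => lt_c; apply: no_pair.
exists (g i), (g j); split=> //; first exact: g_incr.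
by rewrite ltNge; apply/negP; exact: gb.
Qed.

(** The two outer errors and [delta] add up to [gamma], which explains the constant
    [(gamma - delta) / 2]. *)
Lemma dist_chain_lt (R : realFieldType) (V : normedZmodType R)
    (p u v w z q : V) (eps delta gamma : R) :
  `|u - p| < (gamma - delta) / 2 -> `|v - u| < eps -> `|v - w| < delta ->
  `|w - z| < eps -> `|z - q| < (gamma - delta) / 2 ->
  `|p - q| < 2 * eps + gamma.
Proof.
have := ler_distD u p q; have := ler_distD v u q.
have := ler_distD w v q; have := ler_distD z w q.
rewrite (distrC p u) (distrC u v); lra.
Qed.

Theorem proposition3p3 (R : realType) (iota : real_copy R) (L : language R)
    (M : structure L) (x y : vartuple (lsort L)) (K : set (ellinf R))
    (phi : formula iota (vcat x y) K)
    (eps : R) (eps_gt0 : 0 < eps) (phi_stable : eps_stable phi M eps)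
    (gamma delta : R) (delta_gt0 : 0 < delta) (delta_lt : delta < gamma)
    (p : phi_type phi M) :
  exists (n : nat) (a : 'I_n -> M ^^ x), forall b c : M ^^ y,
    (forall i : 'I_n,
       `|feval phi (pcat (a i) b) - feval phi (pcat (a i) c)| < delta) ->
    `|p b - p c| < 2 * eps + gamma.
Proof.
apply: contrapT => no_family.
pose f (a : M ^^ x) (b : M ^^ y) := feval phi (pcat a b).
pose eta := (gamma - delta) / 2.
have eta0 : 0 < eta by rewrite divr_gt0 // subr_gt0.
pose T := ((M ^^ x) * (M ^^ y) * (M ^^ y))%type.
pose t0 : T := ((fun=> point), (fun=> point), (fun=> point)).
(* Here [s] precedes [t]. The new [b], [c] are constrained only by old [a], and the new [a] only by
   old [b], [c], so the two choices within a step are independent. *)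
have [|g [gD gR]] := @history_choice T t0
    (fun t => 2 * eps + gamma <= `|p t.1.2 - p t.2|)
    (fun s t => [/\ `|f s.1.1 t.1.2 - f s.1.1 t.2| < delta,
      `|f t.1.1 s.1.2 - p s.1.2| < eta & `|f t.1.1 s.2 - p s.2| < eta]).
  move=> s _; pose t (i : 'I_(size s)) := nth t0 s i.
  have [b [c [fbc pbc]]] : exists b c,
      (forall i, `|f (t i).1.1 b - f (t i).1.1 c| < delta) /\
      2 * eps + gamma <= `|p b - p c|.
    apply: contrapT => no_bc; apply: no_family.
    exists (size s), (fun i => (t i).1.1) => b c fbc.
    by rewrite ltNge; apply/negP => pbc; apply: no_bc; exists b, c.
  (* The index set is doubled so that one [a] serves all earlier [b] and all earlier [c]. *)
  have [a aP] := phi_type_approx p (fun k : 'I_(size s + size s) =>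
    match fintype.split k with inl i => (t i).1.2 | inr i => (t i).2 end) eta0.
  exists (a, b, c); split=> // i lt_is; pose k := Ordinal lt_is; split.
  - exact: (fbc k).
  - by have := aP (fintype.unsplit (inl k)); rewrite fintype.unsplitK.
  - by have := aP (fintype.unsplit (inr k)); rewrite fintype.unsplitK.
have [i [j [lt_ij]]] : exists i j, [/\ (i < j)%N,
    `|f (g i).1.1 (g j).1.2 - f (g j).1.1 (g i).1.2| < eps &
    `|f (g i).1.1 (g j).2 - f (g j).1.1 (g i).2| < eps].
  exact: (eps_stable_common_pair (fun n => (g n).1.1) (fun n => (g n).1.2)
    (fun n => (g n).2) phi_stable).
have := gD i; have [] := gR _ _ lt_ij.
move: (g i) (g j) => [[ai bi] ci] [[aj bj] cj] /=.
move=> lt_delta apx_b apx_c far_p lt_b lt_c.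
have := dist_chain_lt apx_b lt_b lt_delta lt_c apx_c.
by rewrite ltNge far_p.
Qed.
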